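(* For $c\geq 3$ and an integer $n$, let $s(c,2n)$ be the number of elements of the partially-double-counted set $T(c)$ of 2-bridge knots with crossing number $c$ that have signature $2n$. (i) If $c=2m$ is even, then for every integer $n$, $$s(2m,2n)=\sum_{i=0}^{m-|n|-2}\binom{2m-4-2i}{m+n-2-i}.$$ (ii) If $c=2m+1$ is odd, then for every integer $n\neq 1$, $$s(2m+1,2n)=\sum_{i=0}^{\min\{m+n-3,\;m-n\}}\binom{2m-3-2i}{m+n-3-i},$$ and for $n=1$, $$s(2m+1,2)=1+\sum_{i=0}^{m-2}\binom{2m-3-2i}{m-2-i},$$ which is one more than the value given by the preceding formula at $n=1$. Sums whose upper limit is negative are empty and equal $0$.
   Context: **The set $T(c)$.** For $c\ge 3$, $T(c)$ is the set of words in the symbols $\{+,-\}$ consisting of exactly $c$ maximal runs, of lengths $\varepsilon_1,\dots,\varepsilon_c\in\{1,2\}$, beginning with a run of $+$ (so the $i$-th run is of $+$ for $i$ odd and of $-$ for $i$ even), with $\varepsilon_1=\varepsilon_c=1$ and $\sum_{i=1}^c\varepsilon_i\equiv 1 \pmod 3$. It is called the partially-double-counted set of 2-bridge knots with crossing number $c$: up to mirror image, each such knot is represented by one word if its word is palindromic ($\varepsilon_i=\varepsilon_{c+1-i}$ for all $i$) and by exactly two words otherwise. **The knot of a word.** Replace the runs in order by braid letters: the runs $+$ and $--$ become $\sigma_1$, and the runs $-$ and $++$ become $\sigma_2^{-1}$. Draw four horizontal strands at heights $-1,0,1,2$, read left to right. A letter $\sigma_1$ is a crossing between heights $0$ and $1$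 in which the strand of positive slope passes over; a letter $\sigma_2^{-1}$ is a crossing between heights $1$ and $2$ in which the strand of negative slope passes over; the strand at height $-1$ has no crossings. On the left, join height $1$ to height $2$ and height $-1$ to height $0$ by arcs. On the right, if $c$ is odd (last letter $\sigma_1$) join $1$ to $2$ and $-1$ to $0$; if $c$ is even (last letter $\sigma_2^{-1}$) join $0$ to $1$ and $-1$ to $2$ by nested arcs. The result is an alternating diagram of a 2-bridge knot with crossing number $c$. **Signature.** The signature of a knot is the signature (number of positive minus number of negative eigenvalues) of $V+V^T$ for a Seifert matrix $V$, with the sign convention that the right-handed (positive) trefoil has signature $-2$. It is always an even integer. The signature of an element of $T(c)$ is the signature of the knot it represents, and $s(c,\sigma)$ is the number of words in $T(c)$ with signature $\sigma$. *)

(* Defs.v *)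
From mathcomp Require Import all_boot all_order all_algebra all_field.

Set Implicit Arguments.
Unset Strict Implicit.
Unset Printing Implicit Defensive.

Import Order.TTheory GRing.Theory Num.Theory.
Local Open Scope ring_scope.

(* A word in {+,-} is a [seq bool], with [true] for + and [false] for -.
   [runs w] lists the maximal runs of [w] as pairs (symbol, length). *)
Fixpoint runs (w : seq bool) : seq (bool * nat) :=
  if w is a :: w' then
    if runs w' is (b, k) :: r then
      if a == b then (b, k.+1) :: r else [:: (a, 1%N), (b, k) & r]
    else [:: (a, 1%N)]
  else [::].

Definition run_lengths (w : seq bool) : seq nat := [seq r.2 | r <- runs w].

Definition in_T (c : nat) (w : seq bool) : bool :=
  let e := run_lengths w in
  [&& size e == c,
      all (fun k => (k == 1%N) || (k == 2%N)) e,
      head false w,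
      head 0%N e == 1%N,
      last 0%N e == 1%N
    & (sumn e == 1 %[mod 3])%N].

(* A word with c runs of length 1 or 2 has at most 2c symbols, so bounding the
   length by 2c excludes no word and makes the ambient type finite. *)
Definition T (c : nat) : {set (2 * c).-bseq bool} :=
  [set w : (2 * c).-bseq bool | in_T c w].

Inductive letter := Sigma1 | Sigma2Inv.

Definition is_Sigma1 (x : letter) : bool := if x is Sigma1 then true else false.

Definition run_letter (r : bool * nat) : letter :=
  if r.1 == (r.2 == 1%N) then Sigma1 else Sigma2Inv.

Definition letters (w : seq bool) : seq letter := map run_letter (runs w).

(* The strands at heights -1, 0, 1, 2 are numbered 0, 1, 2, 3.  A letter [x]
   crosses the strands [level x] and [(level x).+1].  "Column k" is the vertical
   strip between the (k-1)-st and the k-th crossing, crossings being counted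
   from 0. *)
Definition level (x : letter) : nat := if x is Sigma1 then 1%N else 2%N.

Definition swap (x : letter) (h : nat) : nat :=
  if h == level x then (level x).+1
  else if h == (level x).+1 then level x else h.

(* An orientation is recorded column by column as a map [d] from strand numbers
   to [bool], [true] meaning "from left to right".  [transport d b] is the
   orientation after the letters [b] when it is [d] before them. *)
Definition transport (d : nat -> bool) (b : seq letter) : nat -> bool :=
  foldl (fun d x h => d (swap x h)) d b.

(* Orientations of column 0 compatible with the left arcs, up to reversal of
   the whole diagram: strand 0 goes right, strand 1 left, and strands 2 and 3
   have opposite directions. *)
Definition left_end (u : bool) (h : nat) : bool :=
  nth false [:: true; false; u; ~~ u] h.

(* Compatibility with the right arcs. *)
Definition right_end_ok (b : seq letter) (d : nat -> bool) : bool :=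
  if odd (size b) then (d 2%N != d 3%N) && (d 0%N != d 1%N)
  else (d 1%N != d 2%N) && (d 0%N != d 3%N).

(* When the diagram has one component, exactly one of [left_end true] and
   [left_end false] is compatible with the right arcs.  The choice of direction
   for strand 0 does not matter: the signature of a knot does not change when
   the orientation is reversed. *)
Definition orientation (b : seq letter) : nat -> bool :=
  left_end (right_end_ok b (transport (left_end true) b)).

(* [region b k l] names the face of the diagram lying, in column [k], between
   the strands [l] and [l.+1] (above all strands if [l = 3]).  The faces between
   two given strands are numbered from left to right, a crossing of these
   strands separating consecutive ones.  The closing arcs identify some of them:
   on the left, the first face between strands 1 and 2 is open to the outer
   face; on the right, so is the last one if there is an odd number of
   crossings, and otherwise the last face between strands 2 and 3 passes between
   the two nested arcs into the face between strands 0 and 1.  The values not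
   taken by [region] are not faces of the diagram; being isolated for
   [band_adjacent] below, they do not enter [basis_faces]. *)
Definition face (b : seq letter) : finType := ('I_4 * 'I_(size b).+1)%type.

Definition region (b : seq letter) (k l : nat) : face b :=
  let j := count (fun x => level x == l) (take k b) in
  let last_gap := j == count (fun x => level x == l) b in
  let outer := (inord 3, inord 0) in
  let bottom := (inord 0, inord 0) in
  match l with
  | 0 => bottom
  | 1 => if (j == 0%N) || odd (size b) && last_gap then outer
         else (inord 1, inord j)
  | 2 => if ~~ odd (size b) && last_gap then bottom else (inord 2, inord j)
  | _ => outer
  end.

(* A crossing of an oriented diagram, turned so that both strands point up, with
   its sign and three of the four faces around it: [front] is above the
   crossing, [back] is below it and [left_face] is on its left. *)
Record crossing (F : Type) : Type := Crossing {
  positive : bool;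
  front : F;
  back : F;
  left_face : F
}.

(* [rising] and [falling] say whether the strand of positive (negative) slope is
   oriented from left to right.  If they agree, the strand of positive slope
   passes over the other one exactly in negative crossings. *)
Definition plat_crossing (b : seq letter) (k : nat) : crossing (face b) :=
  let x := nth Sigma1 b k in
  let l := level x in
  let d := transport (orientation b) (take k b) in
  let rising := d l in
  let falling := d l.+1 in
  let W := region b k l in
  let E := region b k.+1 l in
  let N := region b k l.+1 in
  let S := region b k l.-1 in
  let pos := is_Sigma1 x (+) (rising == falling) in
  match rising, falling with
  | true, true => Crossing pos E W N
  | false, false => Crossing pos W E S
  | true, false => Crossing pos N S W
  | false, true => Crossing pos S N E
  end.

Definition plat_diagram (b : seq letter) : seq (crossing (face b)) :=
  [seq plat_crossing b k | k <- iota 0 (size b)].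

(* Let Sigma be the surface produced by Seifert's algorithm from a connected
   oriented diagram D: a disc for each Seifert circle C, consisting of a vertical
   collar that rises from C and of a cap above it, and a half-twisted band for
   each crossing.  For a face f of D let a_f be the loop on Sigma that goes once
   around f, counterclockwise, along the Seifert circles and the bands.  It
   crosses the band of x from left to right if f = front x, from right to left
   if f = back x, and otherwise not at all.

   Compute lk(a_f, a_g^+), where a_g^+ is a_g pushed off to the positive side of
   Sigma (the right-hand side of each collar, seen along C), by adding the signs
   of the crossings of the projection in which a_g^+ is above a_f.  On each
   collar let the loops coming from the left of C run higher than those coming
   from the right.  Then a_g^+ is above a_f only at the left-hand end of a band x
   crossed by a_f, where it runs
   - forward along the left-hand Seifert circle, if g = left_face x;
   - backward along it, if x is positive and g = back x, or x is negative and
     g = front x (the twist of the band carries the push-off of the other one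
     of these two loops past a_f from the other side).
   When a_f goes from left to right, the sign is -1 in the first case and +1 in
   the second; it is reversed when a_f goes from right to left. *)
Definition seifert_pairing (F : finType) (D : seq (crossing F)) (f g : F) :
    int :=
  \sum_(x <- D)
    ((f == front x)%:Z - (f == back x)%:Z)
    * ((g == if positive x then back x else front x)%:Z
       - (g == left_face x)%:Z).

(* Two faces separated by a band.  The classes of the generated equivalence are
   the sets of faces lying in the same component of the complement of the
   Seifert circles. *)
Definition band_adjacent (F : finType) (D : seq (crossing F)) : rel F :=
  fun f g => has (fun x => (f == front x) && (g == back x)
                        || (f == back x) && (g == front x)) D.

(* The loops a_f generate H_1(F), and the relations between them are generated
   by: the sum of the a_f over a component of the complement of the Seifert
   circles is a sum of Seifert circles, hence 0.  Leaving out one face in each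
   component therefore gives a basis of H_1(F). *)
Definition basis_faces (F : finType) (D : seq (crossing F)) : {set F} :=
  [set f | fingraph.root (band_adjacent D) f != f].

Definition seifert_matrix (F : finType) (D : seq (crossing F)) :
    'M[int]_#|basis_faces D| :=
  \matrix_(i, j) seifert_pairing D (enum_val i) (enum_val j).

(* The complex eigenvalues, listed with their multiplicities. *)
Definition eigenvalues (n : nat) (A : 'M[int]_n) : seq algC :=
  sval (closed_field_poly_normal (char_poly (map_mx intr A : 'M[algC]_n))).

(* In [algC], [0 < z] and [z < 0] imply that [z] is real. *)
Definition mx_signature (n : nat) (A : 'M[int]_n) : int :=
  (count (fun z => 0 < z) (eigenvalues A))%:Z
  - (count (fun z => z < 0) (eigenvalues A))%:Z.

Definition diagram_signature (F : finType) (D : seq (crossing F)) : int :=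
  mx_signature (seifert_matrix D + (seifert_matrix D)^T).

Definition word_signature (w : seq bool) : int :=
  diagram_signature (plat_diagram (letters w)).

Definition s (c : nat) (sigma : int) : nat :=
  #|[set w in T c | word_signature w == sigma]|.

(* The sum over 0 <= i <= u, which is empty for u < 0. *)
Definition sum_upto (u : int) (f : nat -> nat) : nat :=
  if u is Posz k then (\sum_(0 <= i < k.+1) f i)%N else 0%N.

Definition binomialz (a b : int) : nat :=
  match a, b with
  | Posz a', Posz b' => 'C(a', b')
  | _, _ => 0%N
  end.

Arguments sum_upto u%_R f.
Arguments binomialz (a b)%_R.
Arguments s c%_N sigma%_R.

(* Main.v *)
Require Import Defs.
From HB Require Import structures.
From mathcomp Require Import all_boot all_order all_algebra all_field.
From mathcomp Require Import zify ring.
Set Implicit Arguments.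
Unset Strict Implicit.
Unset Printing Implicit Defensive.
Import Order.TTheory GRing.Theory Num.Theory.
Local Open Scope ring_scope.

(** In an alternating diagram whose crossings have the stated signs, the loops
around the faces in odd gaps meet only negative bands and the loops around the
faces in even gaps only positive ones.  Every face is as often in front of a
crossing as behind one, so on loops of one kind the form [V + V^T] is, up to
sign, the sum of the [|x_front - x_back|^2]: it is positive definite on the odd
faces, negative definite on the even ones, and the signature is the number of
odd basis faces minus the number of even ones.

Adding the crossings from left to right, a new band either joins two faces that
are already connected or attaches an isolated face.  Which of these happens
depends only on a four-valued state, so that the signature is the weight of a
path in an automaton; the congruence modulo 3 fixes the final state.

Let [A_k] and [E_k] be the generating functions in [t] of the paths of length
[k] from [Top] to [Bot] and to [Top], and [tau = t + 1/t].  Then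
[E_k + A_(k+1) = tau^k] and [E_(k+1) + A_k = t tau^k], whence
[A_(k+2) = A_k + tau^k / t] and [E_(k+2) = E_k + t^2 tau^k]. *)

(** * Signatures of symmetric matrices *)

Local Open Scope sesquilinear_scope.

Definition hform n (A : 'M[algC]_n) (x : 'rV[algC]_n) : algC :=
  (x *m A *m x^t*) 0 0.

Lemma row_free_rowsub1 n (P : {pred 'I_n}) :
  row_free (rowsub (fun i : 'I_#|P| => enum_val i) (1%:M : 'M[algC]_n)).
Proof.
apply/row_freeP; exists (colsub (fun i : 'I_#|P| => enum_val i) 1%:M).
apply/matrixP=> i j; rewrite !mxE (bigD1 (enum_val i)) //= big1 => [|k /negbTE nk].
  by rewrite !mxE eqxx mul1r addr0 (inj_eq enum_val_inj).
by rewrite !mxE eq_sym nk mul0r.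
Qed.

Lemma mul_rowsub1_out n (P : {pred 'I_n}) (u : 'rV[algC]_#|P|) (i : 'I_n) :
  i \notin P ->
  (u *m rowsub (fun i : 'I_#|P| => enum_val i) (1%:M : 'M[algC]_n)) 0 i = 0.
Proof.
move=> Pi; rewrite mxE big1 // => k _; rewrite !mxE.
case: eqP => [ek|_]; last by rewrite mulr0.
by rewrite -ek enum_valP in Pi.
Qed.

(** The dimension formula for the sum and intersection of the two row spaces leaves an intersection
    of positive rank. *)
Lemma row_free_overlap p q n (U : 'M[algC]_(p, n)) (W : 'M[algC]_(q, n)) :
  row_free U -> row_free W -> (n < p + q)%N ->
  exists (u : 'rV_p) (v : 'rV_q), u *m U = v *m W /\ u *m U != 0.
Proof.
rewrite /row_free => /eqP rU /eqP rW lt_n.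
have /lt0n_neq0 : (0 < \rank (U :&: W)%MS)%N.
  have := mxrank_sum_cap U W; rewrite rU rW => e.
  have := rank_leq_col (U + W)%MS; rewrite -(ltn_add2l (\rank (U + W)%MS)) e addn0.
  by move=> h; apply: leq_ltn_trans h lt_n.
rewrite mxrank_eq0 => /rowV0Pn[x]; rewrite sub_capmx => /andP[/submxP[u ->]].
by case/submxP=> v e nz; exists u, v.
Qed.

Lemma hform_diag n (Q : 'M[algC]_n) (d y : 'rV[algC]_n) :
  Q \is unitarymx ->
  hform (invmx Q *m diag_mx d *m Q) (y *m Q) = \sum_i d 0 i * `|y 0 i| ^+ 2.
Proof.
move=> uQ; rewrite /hform trmx_mul map_mxM invmx_unitary //.
have e : Q *m Q^t* = 1%:M by apply/unitarymxP.
rewrite !mulmxA -(mulmxA y) e mulmx1 -(mulmxA _ Q) e mulmx1 mxE.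
apply: eq_bigr => i _.
by rewrite mul_mx_diag !mxE normCK mulrAC mulrC mulrA.
Qed.

(** One half of Sylvester's law of inertia. If [P] had more elements than [d] has positive entries,
    the coordinate space of [P] would meet the span of the eigenvectors with nonpositive
    eigenvalues, where the form cannot be positive. *)
Lemma card_definite_le n (Q : 'M[algC]_n) (d : 'rV[algC]_n) (P : {pred 'I_n}) :
  Q \is unitarymx -> d \is a mxOver Num.real ->
  (forall x : 'rV_n, x != 0 -> (forall i, i \notin P -> x 0 i = 0) ->
     0 < hform (invmx Q *m diag_mx d *m Q) x) ->
  (#|P| <= #|[pred i | (0 < d 0%R i)%R]|)%N.
Proof.
move=> uQ /mxOverP rd posP; rewrite leqNgt; apply/negP=> lt_pos.
set N := [predC [pred i | (0 < d 0%R i)%R]].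
have [||u [v [e nz]]] := row_free_overlap (row_free_rowsub1 P)
    (W := rowsub (fun i : 'I_#|N| => enum_val i) (1%:M : 'M[algC]_n) *m Q).
- rewrite /row_free mxrankMfree ?row_free_unit ?unitarymx_unit //.
  exact: row_free_rowsub1.
- by rewrite -[X in (X < _)%N](card_ord n) -(cardC [pred i | (0 < d 0%R i)%R]) ltn_add2r.
have := posP _ nz (fun i => mul_rowsub1_out u (i := i)).
rewrite e mulmxA hform_diag // => /lt_geF /negP; apply.
apply: sumr_le0 => i _; have [Ni|Ni] := boolP (i \in N); last first.
  by rewrite mul_rowsub1_out // normr0 expr0n mulr0.
rewrite mulr_le0_ge0 ?exprn_ge0 //.
by move: Ni; rewrite !inE -real_leNgt ?real0 // (rd 0 i).
Qed.

Lemma char_poly_conj n (Q A : 'M[algC]_n) :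
  Q \in unitmx -> char_poly (invmx Q *m A *m Q) = char_poly A.
Proof.
move=> uQ; set QP := map_mx polyC Q; set QI := map_mx polyC (invmx Q).
have QK : QI *m QP = 1%:M by rewrite -map_mxM mulVmx // map_mx1.
rewrite /char_poly.
have -> : char_poly_mx (invmx Q *m A *m Q) = QI *m char_poly_mx A *m QP.
  rewrite /char_poly_mx mulmxBr mulmxBl !map_mxM -scalemx1.
  by rewrite -scalemxAr -scalemxAl mulmx1 QK.
by rewrite !det_mulmx mulrAC -det_mulmx QK det1 mul1r.
Qed.

(** [card_definite_le] for [A] and for [-A] bounds both eigenvalue counts from below; the two bounds
    add up to [n], so both are attained. *)
Lemma mx_signature_split n (A : 'M[int]_n) (P : {pred 'I_n}) :
  A^T = A ->
  (forall x : 'rV_n, x != 0 -> (forall i, i \notin P -> x 0 i = 0) ->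
     0 < hform (map_mx intr A) x) ->
  (forall x : 'rV_n, x != 0 -> (forall i, i \in P -> x 0 i = 0) ->
     hform (map_mx intr A) x < 0) ->
  mx_signature A = #|P|%:Z - #|[predC P]|%:Z.
Proof.
move=> symA posP negP; set AC : 'M[algC]_n := map_mx intr A.
have hermA : AC \is hermsymmx.
  apply: realsym_hermsym.
    apply/is_hermitianmxP; rewrite expr0 scale1r map_mx_id //.
    by apply/matrixP=> i j; rewrite !mxE -[in RHS]symA mxE.
  by apply/mxOverP=> i j; rewrite mxE realz.
have normA := hermitian_normalmx hermA.
have /orthomx_spectralP eA := normA.
have rd := hermitian_spectral_diag_real hermA.
have uQ := spectral_unitarymx AC.
move: (spectralmx AC) (spectral_diag AC) => Q d in eA rd uQ *.
have le_pos : (#|P| <= #|[pred i | (0 < d 0%R i)%R]|)%N.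
  by apply: card_definite_le uQ rd _; rewrite -eA.
have le_neg : (#|[predC P]| <= #|[pred i | (d 0%R i < 0)%R]|)%N.
  have -> : #|[pred i | (d 0%R i < 0)%R]| = #|[pred i | (0 < (- d) 0%R i)%R]|.
    by apply: eq_card => i; rewrite !inE mxE oppr_gt0.
  apply: card_definite_le uQ _ _.
    by apply/mxOverP=> i j; rewrite mxE rpredN; move/mxOverP: rd.
  move=> x nz Px; rewrite raddfN /= mulmxN mulNmx -eA.
  rewrite /hform mulmxN mulNmx mxE oppr_gt0; apply: negP => // i Pi.
  by apply: Px; rewrite !inE Pi.
(* Conjugation preserves the characteristic polynomial, so the listed eigenvalues are the diagonal
   entries up to order. *)
have eig : perm_eq (eigenvalues A) [seq d 0 i | i <- enum 'I_n].
  apply: prod_XsubC_eq; rewrite /eigenvalues; case: closed_field_poly_normal => r /=.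
  rewrite -/AC (monicP (char_poly_monic _)) scale1r => <-.
  rewrite big_map big_enum /=; move: eA; rewrite -/AC => ->.
  rewrite char_poly_conj ?unitarymx_unit // char_poly_trig ?diag_mx_is_trig //.
  by apply: eq_bigr => i _; rewrite mxE eqxx mulr1n.
have cnt (q : pred algC) : count q (eigenvalues A) = #|[pred i | q (d 0%R i)]|.
  by rewrite (permP eig) count_map [RHS]cardE size_filter -enumT; apply: eq_count.
rewrite /mx_signature !cnt.
have le_n : (#|[pred i | (0 < d 0%R i)%R]| + #|[pred i | (d 0%R i < 0)%R]| <= n)%N.
  rewrite -[X in (_ <= X)%N](card_ord n) -(cardC [pred i | (0 < d 0%R i)%R]) leq_add2l.
  by apply/subset_leq_card/subsetP=> i; rewrite !inE => /lt_gtF ->.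
have eP : (#|P| + #|[predC P]| = n)%N by rewrite cardC card_ord.
have e1 : #|[pred i | (0 < d 0%R i)%R]| = #|P| by lia.
have e2 : #|[pred i | (d 0%R i < 0)%R]| = #|[predC P]| by lia.
by congr (_%:Z - _%:Z); [rewrite -[RHS]e1 | rewrite -[RHS]e2].
Qed.

Local Close Scope sesquilinear_scope.

Lemma hform_sum n (A : 'M[algC]_n) (x : 'rV[algC]_n) :
  hform A x = \sum_i \sum_j x 0 i * A i j * (x 0 j)^*.
Proof.
rewrite exchange_big /hform mxE; apply: eq_bigr => j _.
by rewrite !mxE mulr_suml.
Qed.

Lemma sum_normsq_eq0 (I : Type) (r : seq I) (h : I -> algC) :
  \sum_(i <- r) `|h i| ^+ 2 = 0 -> all (fun i => h i == 0) r.
Proof.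
elim: r => //= i r IHr; rewrite big_cons => /eqP.
rewrite paddr_eq0 ?exprn_ge0 //; last by apply: sumr_ge0 => j _; rewrite exprn_ge0.
by rewrite expf_eq0 normr_eq0 /= => /andP[-> /eqP/IHr].
Qed.

(** * Alternating diagrams *)

Section AlternatingDiagram.
Variables (F : finType) (D : seq (crossing F)) (col : F -> bool).

Hypothesis alternating : all (fun x => [&& col (front x) == ~~ positive x,
  col (back x) == ~~ positive x & col (left_face x) == positive x]) D.
Hypothesis balanced : forall y : F -> algC,
  \sum_(x <- D) (y (front x) - y (back x)) = 0.

Let B := basis_faces D.
Let S := seifert_matrix D.
Let adj := band_adjacent D.

(** Lets the form be written as a sum over crossings, whose faces may lie outside the basis. *)
Definition extend (x : 'I_#|B| -> algC) (f : F) : algC :=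
  \sum_i x i * (enum_val i == f)%:R.

Lemma extend_val x i : extend x (enum_val i) = x i.
Proof.
rewrite /extend (bigD1 i) //= eqxx mulr1 big1 ?addr0 // => j /negbTE nj.
by rewrite (inj_eq enum_val_inj) nj mulr0.
Qed.

Lemma extend_out x f : f \notin B -> extend x f = 0.
Proof.
move=> Bf; rewrite /extend big1 // => i _; case: eqP => [e|]; last by rewrite mulr0.
by rewrite -e enum_valP in Bf.
Qed.

Lemma seifert_bilinear (x y : 'I_#|B| -> algC) :
  \sum_i \sum_j x i * (S i j)%:~R * y j =
  \sum_(c <- D) (extend x (front c) - extend x (back c)) *
    (extend y (if positive c then back c else front c) - extend y (left_face c)).
Proof.
under eq_bigr => i _ do under eq_bigr => j _ do
  rewrite mxE /seifert_pairing rmorph_sum /= mulr_sumr mulr_suml.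
under eq_bigr => i _ do rewrite exchange_big /=.
rewrite exchange_big /=; apply: eq_bigr => c _.
rewrite /extend -!sumrB mulr_suml; apply: eq_bigr => i _.
rewrite mulr_sumr; apply: eq_bigr => j _.
rewrite rmorphM !rmorphB /= -!mulrBr -!mulrA; congr (_ * (_ * _)).
by rewrite mulrC.
Qed.

Lemma hform_seifert (x : 'rV[algC]_#|B|) (X := extend (x 0)) :
  hform (map_mx intr (S + S^T)) x =
  \sum_(c <- D) ((X (front c) - X (back c)) *
      (X (if positive c then back c else front c) - X (left_face c))^* +
    (X (front c) - X (back c))^* *
      (X (if positive c then back c else front c) - X (left_face c))).
Proof.
have exC f : (X f)^* = extend (fun i => (x 0 i)^*) f.
  rewrite /X /extend rmorph_sum; apply: eq_bigr => i _.
  by rewrite rmorphM /= conjC_nat.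
under eq_bigr => c _ do rewrite !rmorphB /= !exC.
rewrite big_split /= -2!seifert_bilinear.
rewrite [X in _ = _ + X]exchange_big -big_split /= hform_sum.
apply: eq_bigr => i _; rewrite -big_split /=.
by apply: eq_bigr => j _; rewrite !mxE rmorphD /=; ring.
Qed.

(** Crossings of one sign contribute 0, and at the others [X] vanishes on [left_face]. There the
    term is plus or minus |X_front - X_back|^2, plus the difference |X_front|^2 - |X_back|^2; the
    hypothesis [balanced] cancels these differences. *)
Lemma hform_seifert_definite (side : bool) (x : 'rV[algC]_#|B|)
    (X := extend (x 0)) :
  (forall f, col f != side -> X f = 0) ->
  hform (map_mx intr (S + S^T)) x =
  (-1) ^+ (~~ side) * \sum_(c <- D) `|X (front c) - X (back c)| ^+ 2.
Proof.
move=> supp; rewrite hform_seifert -/X.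
have /= bal := balanced (fun f => `|X f| ^+ 2).
rewrite -[RHS]addr0 -[X in _ = _ + X]bal mulr_sumr -big_split /=.
elim: (D) alternating => [|c s IHs] /=; first by rewrite !big_nil.
case/andP=> /and3P[/eqP cf /eqP cb /eqP cl] /IHs{}IHs; rewrite !big_cons {}IHs.
congr (_ + _); rewrite !normCK !rmorphB /=.
case: side supp; case: positive cf cb cl => cf cb cl supp /=.
- by rewrite (supp (front c)) ?cf // (supp (back c)) ?cb // rmorph0; ring.
- by rewrite (supp (left_face c)) ?cl // rmorph0; ring.
- by rewrite (supp (left_face c)) ?cl // rmorph0; ring.
- by rewrite (supp (front c)) ?cf // (supp (back c)) ?cb // rmorph0; ring.
Qed.

Lemma adj_sym : connect_sym adj.
Proof.
apply: sym_connect_sym => f g; apply: eq_has => c.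
by rewrite orbC andbC (andbC (f == _)).
Qed.

(** If the sum of squares vanished, [X] would be constant on each component of [adj]; being 0 at the
    root, which lies outside the basis, it would be 0 everywhere. *)
Lemma hform_seifert_gt0 (side : bool) (x : 'rV[algC]_#|B|) :
  x != 0 -> (forall i, col (enum_val i) != side -> x 0 i = 0) ->
  0 < (-1) ^+ (~~ side) * hform (map_mx intr (S + S^T)) x.
Proof.
move=> nz supp; pose X := extend (x 0).
have suppX f : col f != side -> X f = 0.
  case: (boolP (f \in B)) => [Bf|nBf]; last by rewrite /X extend_out.
  rewrite -(enum_rankK_in Bf Bf).
  by move=> /supp; rewrite /X extend_val.
rewrite (hform_seifert_definite suppX) mulrA -signr_addb addbb mul1r -/X.
rewrite lt0r sumr_ge0 ?andbT => [|c _]; last exact: exprn_ge0.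
apply: contra nz => /eqP/sum_normsq_eq0 X0.
have Xadj f g : adj f g -> X f = X g.
  move: X0; rewrite /adj /band_adjacent; elim: (D) => //= c s IHs /andP[/eqP e /IHs{}IHs].
  case/orP=> [/orP[]/andP[/eqP-> /eqP->]|/IHs //].
    by apply/eqP; rewrite -subr_eq0 e.
  by apply/esym/eqP; rewrite -subr_eq0 e.
have Xroot f : X f = X (fingraph.root adj f).
  have /connectP[p] := connect_root adj f; move: (fingraph.root adj f) => g.
  move=> fp ->; elim: p f fp => //= h p IHp f /andP[/Xadj-> /IHp //].
apply/eqP/rowP=> i; rewrite mxE -(extend_val (x 0)) -/X Xroot.
apply: extend_out; rewrite inE negbK (root_root adj_sym) //.
Qed.

Theorem alternating_signature :
  diagram_signature D = \sum_(f in B) (-1) ^+ (~~ col f).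
Proof.
rewrite /diagram_signature (mx_signature_split (P := [pred i | col (enum_val i)])).
- rewrite big_enum_val (bigID [pred i | col (enum_val i)]) /=.
  congr (_ + _).
    rewrite (eq_bigr (fun _ => 1)) => [|i /= ->] //.
    by rewrite sumr_const -mulr_natr mul1r natz.
  rewrite (eq_bigr (fun _ => -1)) => [|i /= /negbTE->] //.
  by rewrite sumr_const -mulr_natr mulN1r natz.
- by rewrite linearD /= trmxK addrC.
- move=> x nz supp; have := hform_seifert_gt0 (side := true) nz; rewrite mul1r; apply.
  by move=> i; rewrite eqb_id => /supp.
- move=> x nz supp; have := hform_seifert_gt0 (side := false) nz; rewrite mulN1r oppr_gt0; apply.
  by move=> i; rewrite eqbF_neg negbK => /supp.
Qed.

End AlternatingDiagram.

(** * Components of a growing graph *)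

Section EdgeList.
Variable F : finType.
Implicit Types (E : seq (F * F)) (f g a b : F) (s : F -> int).

Definition edge_adj E : rel F := fun f g =>
  has (fun e => (f == e.1) && (g == e.2) || (f == e.2) && (g == e.1)) E.

Definition isolated E f : bool := all (fun e => (f != e.1) && (f != e.2)) E.

(** With the front and back faces of the crossings as edges, the range is [basis_faces]. This is the
    sum in [alternating_signature], in a form that can be followed while edges are added. *)
Definition nonroot_sum s E : int :=
  \sum_(f | fingraph.root (edge_adj E) f != f) s f.

Lemma edge_adjC E f g : edge_adj E f g = edge_adj E g f.
Proof. by apply: eq_has => e; rewrite orbC andbC (andbC (f == _)). Qed.

Lemma edge_adj_sym E : connect_sym (edge_adj E).
Proof. exact/sym_connect_sym/edge_adjC. Qed.

Lemma edge_adj_rcons E a b f g :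
  edge_adj (rcons E (a, b)) f g =
  (f == a) && (g == b) || (f == b) && (g == a) || edge_adj E f g.
Proof. by rewrite /edge_adj has_rcons. Qed.

Lemma connect_edge_rcons E a b f g :
  connect (edge_adj E) f g -> connect (edge_adj (rcons E (a, b))) f g.
Proof.
apply: connect_sub => {}f {}g fg; apply: connect1.
by rewrite edge_adj_rcons fg orbT.
Qed.

Lemma connect_last_edge E a b : connect (edge_adj (rcons E (a, b))) a b.
Proof. by apply: connect1; rewrite edge_adj_rcons !eqxx. Qed.

Lemma isolated_rcons E a b f :
  isolated (rcons E (a, b)) f = [&& f != a, f != b & isolated E f].
Proof. by rewrite /isolated all_rcons /= andbA. Qed.

Lemma isolated_adj E f g : isolated E f -> edge_adj E f g = false.
Proof.
by elim: E => //= e E IHE /andP[/andP[/negbTE-> /negbTE->]] /IHE.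
Qed.

Lemma isolated_connect E f g : isolated E f -> connect (edge_adj E) f g = (f == g).
Proof.
move=> isof; apply/idP/eqP => [/connectP[[|h p] /=]|->]; rewrite ?connect0 //.
by rewrite isolated_adj.
Qed.

(** The generated equivalence does not change, and [fingraph.root] depends only on it. *)
Lemma nonroot_sum_connected s E a b :
  connect (edge_adj E) a b -> nonroot_sum s (rcons E (a, b)) = nonroot_sum s E.
Proof.
move=> ab; apply: eq_bigl => f; congr (_ != _).
rewrite /fingraph.root; congr (odflt _ _); apply: eq_pick => g.
apply/idP/idP; last exact: connect_edge_rcons.
apply: connect_sub => {}f {}g; rewrite edge_adj_rcons.
case/orP=> [/orP[]/andP[/eqP-> /eqP->] //|]; last exact: connect1.
by rewrite edge_adj_sym.
Qed.

Lemma connect_edge_const s E f g :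
  all (fun e => s e.1 == s e.2) E -> connect (edge_adj E) f g -> s f = s g.
Proof.
move=> sE /connectP[p]; elim: p f => [|h p IHp] f /=; first by move=> _ ->.
case/andP=> fh /IHp{}IHp /IHp <-; elim: E sE fh {IHp} => //= e E IHE /andP[/eqP se /IHE{}IHE].
by case/orP=> [/orP[]/andP[/eqP-> /eqP->]|/IHE //].
Qed.

(** The component of [b] merges into that of [a], so one root is lost. The other roots may move
    within their components, which does not affect the sum because [s] is constant there. *)
Lemma nonroot_sum_isolated s E a b :
  all (fun e => s e.1 == s e.2) (rcons E (a, b)) ->
  isolated E b -> a != b ->
  nonroot_sum s (rcons E (a, b)) = nonroot_sum s E + s b.
Proof.
set E' := rcons E (a, b) => sE' isob neq_ab.
pose rt := fingraph.root (edge_adj E); pose rt' := fingraph.root (edge_adj E').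
have split e : nonroot_sum s e =
    \sum_f s f - \sum_(f | fingraph.root (edge_adj e) f == f) s f.
  by rewrite [X in X - _](bigID (fun f => fingraph.root (edge_adj e) f == f)) /= addrAC subrr add0r.
have rtK f : rt (rt f) = rt f by rewrite /rt root_root //; apply: edge_adj_sym.
have rtK' f : rt' (rt' f) = rt' f by rewrite /rt' root_root //; apply: edge_adj_sym.
have rtb : rt b = b.
  by apply/esym/eqP; rewrite -(isolated_connect _ isob) connect_root.
(* Contracting the new edge to [a] turns paths of the new graph into paths of the old one. *)
have collapse f g : connect (edge_adj E') f g ->
    connect (edge_adj E) (if f == b then a else f) (if g == b then a else g).
  case/connectP=> p; elim: p f => [|h p IHp] f /=; first by move=> _ ->.
  case/andP=> fh /IHp{}IHp /IHp; apply: connect_trans; move: fh.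
  rewrite edge_adj_rcons => /orP[|fh].
    by case/orP=> /andP[/eqP-> /eqP->]; rewrite eqxx (negbTE neq_ab).
  case: eqP => [e|_]; first by rewrite e isolated_adj in fh.
  case: eqP => [e|_]; last exact: connect1.
  by rewrite e edge_adjC isolated_adj in fh.
(* The old roots other than [b] represent each new component once. *)
have img : [set f | rt' f == f] = rt' @: [set f | (rt f == f) && (f != b)].
  apply/setP=> f; rewrite inE; apply/eqP/imsetP => [rf|[g _ ->]]; last exact: rtK'.
  have rt_b h : rt h = b -> h = b.
    move=> rh; apply/esym/eqP; rewrite -(isolated_connect _ isob) edge_adj_sym.
    by rewrite -rh connect_root.
  have [/rt_b fb|rfb] := eqVneq (rt f) b.
    exists (rt a).
      by rewrite inE rtK eqxx; apply/eqP => /rt_b ab; rewrite ab eqxx in neq_ab.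
    rewrite -rf fb; apply/eqP; rewrite root_connect; last exact: edge_adj_sym.
    rewrite edge_adj_sym; apply: connect_trans (connect_last_edge E a b).
    by rewrite edge_adj_sym; apply: connect_edge_rcons; apply: connect_root.
  exists (rt f); first by rewrite inE rtK eqxx.
  rewrite -rf; apply/eqP; rewrite root_connect; last exact: edge_adj_sym.
  by rewrite rf; apply: connect_edge_rcons; apply: connect_root.
rewrite !split -/rt -/rt'.
have -> : \sum_(f | rt' f == f) s f = \sum_(f | (rt f == f) && (f != b)) s f.
  transitivity (\sum_(f in [set f | rt' f == f]) s f).
    by apply: eq_bigl => f; rewrite inE.
  rewrite img big_imset /= => [|f g]; last first.
    rewrite !inE => /andP[/eqP rf nf] /andP[/eqP rg ng] /eqP.
    rewrite root_connect => [/collapse|]; last exact: edge_adj_sym.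
    rewrite (negbTE nf) (negbTE ng) -root_connect -/rt ?rf ?rg; last exact: edge_adj_sym.
    by move/eqP.
  apply: eq_big => f; first by rewrite inE.
  by move=> _; apply/esym/(connect_edge_const sE'); apply: connect_root.
rewrite [X in _ = _ - X + _](bigD1 b) /= ?rtb //; ring.
Qed.

End EdgeList.

(** * The plat diagram of a word *)

(* Apart from strand 0 one strand goes to the right; the state records its height
   and, at height 2, whether the current face between strands 1 and 2 is
   connected to the outer face by the bands so far ([MidTop]), as it always is in
   state [Top], or the current face between strands 2 and 3 is connected to the
   bottom face ([MidBot]), as it always is in state [Bot].  The other of the two
   current faces is then isolated. *)
Inductive state := Bot | MidBot | MidTop | Top.

Definition height (q : state) : nat :=
  match q with Bot => 1 | MidBot | MidTop => 2 | Top => 3 end.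

Definition next (q : state) (x : letter) : state :=
  match x, q with
  | Sigma1, Bot => MidBot
  | Sigma1, Top => Top
  | Sigma1, _ => Bot
  | Sigma2Inv, Bot => Bot
  | Sigma2Inv, Top => MidTop
  | Sigma2Inv, _ => Top
  end.

(** The contribution of the band of [x] to the signature: 1 or -1 if it attaches an isolated face in
    an odd or even gap, 0 if it joins faces already connected. *)
Definition gain (q : state) (x : letter) : int :=
  match x, q with
  | Sigma1, Top => 1
  | Sigma1, MidTop => -1
  | Sigma2Inv, Bot => -1
  | Sigma2Inv, MidBot => 1
  | _, _ => 0
  end.

Definition step (p : state * int) (x : letter) : state * int :=
  (next p.1 x, p.2 + gain p.1 x).

Definition walk (b : seq letter) : state * int := foldl step (Top, 0) b.

Lemma walk_rcons b x : walk (rcons b x) = step (walk b) x.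
Proof. by rewrite /walk foldl_rcons. Qed.

(** * Orientations along the braid *)

Lemma swap_eq x h p : (swap x h == p) = (h == swap x p).
Proof. by rewrite /swap; case: x => /=; do ![case: eqP => /=] => *; lia. Qed.

Lemma height_next q x : height (next q x) = swap x (height q).
Proof. by case: q; case: x. Qed.

Lemma transport_rcons d b x h : transport d (rcons b x) h = transport d b (swap x h).
Proof. by rewrite /transport foldl_rcons. Qed.

Definition carry (p : nat) (b : seq letter) : nat := foldl (fun p x => swap x p) p b.

Lemma carry_rcons p b x : carry p (rcons b x) = swap x (carry p b).
Proof. by rewrite /carry foldl_rcons. Qed.

Lemma transport_left_end u b h :
  transport (left_end u) b h = (h == 0%N) || (h == carry (if u then 2 else 3) b).
Proof.
elim/last_ind: b h => [|b x IHb] h.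
  by case: u; case: h => [|[|[|[|[]]]]].
rewrite transport_rcons IHb carry_rcons !swap_eq; congr (_ || _).
by case: x.
Qed.

Lemma height_walk b : height (walk b).1 = carry 3 b.
Proof.
elim/last_ind: b => //= b x IHb.
by rewrite walk_rcons carry_rcons height_next IHb.
Qed.

Arguments region : simpl never.

Section PlatDiagram.
Variable b : seq letter.
Let n := size b.

Hypothesis n_gt0 : (0 < n)%N.
Hypothesis last_letter : last Sigma1 b = if odd n then Sigma1 else Sigma2Inv.
(** This rules out [left_end true], so that the second rightgoing strand starts as strand 3, in
    agreement with the initial state [Top] of [walk]. *)
Hypothesis orientation_b : right_end_ok b (transport (left_end true) b) = false.
Hypothesis last_state : (walk b).1 = if odd n then Top else Bot.

Let lt k := nth Sigma1 b k.
Let st k := (walk (take k b)).1.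
Let cnt (l k : nat) := count (fun x => level x == l) (take k b).

Lemma st_succ k : (k < n)%N -> st k.+1 = next (st k) (lt k).
Proof. by move=> kn; rewrite /st (take_nth Sigma1) // walk_rcons. Qed.

Lemma cnt_succ l k : (k < n)%N -> cnt l k.+1 = (cnt l k + (level (lt k) == l))%N.
Proof. by move=> kn; rewrite /cnt (take_nth Sigma1) // -cats1 count_cat /= addn0. Qed.

Lemma cnt_le l k : (cnt l k <= n)%N.
Proof. by rewrite (leq_trans (count_size _ _)) // size_take_min geq_minr. Qed.

(** The last crossing lies in this gap and is still to come, so the test [last_gap] of [region]
    fails there before column [n]. *)
Lemma cnt_lt_last k : (k < n)%N ->
  (cnt (level (last Sigma1 b)) k < cnt (level (last Sigma1 b)) n)%N.
Proof.
move=> kn; have e : n = n.-1.+1 by rewrite prednK.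
have le_k : (k <= n.-1)%N by rewrite -ltnS -e.
rewrite [in X in (_ < X)%N]e cnt_succ; last by rewrite -e.
rewrite /lt nth_last eqxx addn1 ltnS.
rewrite /cnt -(subnKC le_k) takeD count_cat; exact: leq_addr.
Qed.

Lemma region_bottom k : region b k 0 = (inord 0, inord 0). Proof. by []. Qed.

Lemma region_outer k : region b k 3 = (inord 3, inord 0). Proof. by []. Qed.

Lemma region1E k : (k < n)%N -> region b k 1 =
  if cnt 1 k == 0%N then (inord 3, inord 0) else (inord 1, inord (cnt 1 k)).
Proof.
move=> kn; rewrite /region -/(cnt 1 k); case: eqP => //= _.
case on: (odd _) => //=; have := cnt_lt_last kn; rewrite last_letter on /=.
by rewrite /cnt take_size => /ltn_eqF ->.
Qed.

Lemma region2E k : (k < n)%N -> region b k 2 = (inord 2, inord (cnt 2 k)).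
Proof.
move=> kn; rewrite /region -/(cnt 2 k); case on: (odd _) => //=.
have := cnt_lt_last kn; rewrite last_letter on /=.
by rewrite /cnt take_size => /ltn_eqF ->.
Qed.

(** The closing arcs identify gap 1 only with gap 3 and gap 2 only with gap 0, so the parity of the
    gap is a well-defined colouring of the faces. *)
Lemma region_parity k l : (l < 4)%N -> odd (region b k l).1 = odd l.
Proof.
by case: l => [|[|[|[|]]]] // _; rewrite /region; do ?case: ifP => _; rewrite /= inordK.
Qed.

Lemma region1_end : odd n -> region b n 1 = (inord 3, inord 0).
Proof. by move=> on; rewrite /region take_size on eqxx orbT. Qed.

Lemma region2_end : ~~ odd n -> region b n 2 = (inord 0, inord 0).
Proof. by move=> on; rewrite /region take_size on eqxx. Qed.

Lemma region1_Sigma2 k : (k < n)%N -> lt k = Sigma2Inv -> region b k.+1 1 = region b k 1.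
Proof.
by move=> kn ek; rewrite /region -/(cnt 1 k.+1) -/(cnt 1 k) cnt_succ // ek addn0.
Qed.

Lemma region2_Sigma1 k : (k < n)%N -> lt k = Sigma1 -> region b k.+1 2 = region b k 2.
Proof.
by move=> kn ek; rewrite /region -/(cnt 2 k.+1) -/(cnt 2 k) cnt_succ // ek addn0.
Qed.

Lemma plat_crossingE k : plat_crossing b k =
  match lt k, st k with
  | Sigma1, Bot => Crossing true (region b k 2) (region b k 0) (region b k 1)
  | Sigma1, Top => Crossing false (region b k 1) (region b k.+1 1) (region b k 0)
  | Sigma1, _ => Crossing true (region b k 0) (region b k 2) (region b k.+1 1)
  | Sigma2Inv, Bot => Crossing true (region b k 2) (region b k.+1 2) (region b k 1)
  | Sigma2Inv, Top => Crossing false (region b k 1) (region b k 3) (region b k.+1 2)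
  | Sigma2Inv, _ => Crossing false (region b k 3) (region b k 1) (region b k 2)
  end.
Proof.
rewrite /plat_crossing /orientation orientation_b !transport_left_end -height_walk.
by rewrite -/(st k) -/(lt k); case: (lt k); case: (st k).
Qed.

Lemma plat_alternating : all (fun x : crossing (face b) =>
    [&& odd (front x).1 == ~~ positive x,
    odd (back x).1 == ~~ positive x & odd (left_face x).1 == positive x])
  (plat_diagram b).
Proof.
rewrite all_map; apply/allP=> k _ /=; rewrite plat_crossingE.
by case: (lt k); case: (st k); rewrite /= ?region_parity ?inordK.
Qed.

(* The sum of [y] over the four faces met by column [k], each with the number of
   rightgoing strands on its boundary in that column minus 1. *)
Let potential (y : face b -> algC) k : algC :=
  match st k with
  | Bot => y (region b k 0) - y (region b k 2)
  | Top => y (region b k 3) - y (region b k 1)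
  | _ => 0
  end.

Lemma plat_balanced (y : face b -> algC) :
  \sum_(x <- plat_diagram b) (y (front x) - y (back x)) = 0.
Proof.
have step_potential k : (k < n)%N ->
    y (front (plat_crossing b k)) - y (back (plat_crossing b k)) =
    potential y k.+1 - potential y k.
  move=> kn; rewrite plat_crossingE /potential st_succ //.
  have := @region1_Sigma2 k kn; have := @region2_Sigma1 k kn.
  case: (lt k) => [/(_ erefl) e2 _|_ /(_ erefl) e1]; case: (st k) => /=;
    rewrite ?e1 ?e2 ?region_bottom ?region_outer; ring.
rewrite /plat_diagram big_map -/n -[in iota _ _](subn0 n) -/(index_iota 0 n).
rewrite (eq_big_nat _ _ (F2 := fun k => potential y k.+1 - potential y k)) //.
(* The potential vanishes at both ends: in the state reached there, the arcs identify the two faces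
   that it compares. *)
have e0 : region b 0 1 = region b 0 3 by rewrite region1E // /cnt take0.
have st0 : st 0 = Top by rewrite /st take0.
have stn : st n = if odd n then Top else Bot by rewrite /st take_size.
rewrite telescope_sumr // /potential st0 stn e0 subrr subr0.
case: ifP => on; first by rewrite region1_end // region_outer subrr.
by rewrite region2_end ?on // region_bottom subrr.
Qed.

Let edges k : seq (face b * face b) :=
  [seq (front (plat_crossing b i), back (plat_crossing b i)) | i <- iota 0 k].

Let sign (f : face b) : int := (-1) ^+ (~~ odd f.1).

Lemma edges_succ k : edges k.+1 =
  rcons (edges k) (front (plat_crossing b k), back (plat_crossing b k)).
Proof. by rewrite /edges -addn1 iotaD map_cat cats1. Qed.

Lemma edges_sign k : all (fun e => sign e.1 == sign e.2) (edges k).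
Proof.
rewrite all_map; apply/allP=> i _ /=; rewrite plat_crossingE /sign.
by case: (lt i); case: (st i); rewrite /= ?region_parity ?inordK.
Qed.

(* The faces that lie to the right of column [k]. *)
Let fresh k (f : face b) : bool :=
  ((f.1 == 1 :> nat) && (cnt 1 k < f.2)%N) || ((f.1 == 2 :> nat) && (cnt 2 k < f.2)%N).

Lemma fresh_succ k f : (k < n)%N -> fresh k.+1 f -> fresh k f.
Proof.
move=> kn; rewrite /fresh !cnt_succ // => /orP[]/andP[-> h]; apply/orP; [left|right];
  exact: leq_ltn_trans (leq_addr _ _) h.
Qed.

Lemma fresh_region k l : (k < n)%N -> (l < 4)%N -> fresh k (region b k l) = false.
Proof.
move=> kn; case: l => [|[|[|[|]]]] // _.
- by rewrite region_bottom /fresh /= inordK.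
- rewrite region1E // /fresh; case: ifP => _ /=; rewrite !inordK //= ?ltnn //.
  exact: cnt_le.
- by rewrite region2E // /fresh /= !inordK //= ?ltnn //; apply: cnt_le.
- by rewrite region_outer /fresh /= inordK.
Qed.

Lemma region_Sigma1_fresh k : (k.+1 < n)%N -> lt k = Sigma1 -> fresh k (region b k.+1 1).
Proof.
move=> kn ek; have e := cnt_succ 1 (ltnW kn); rewrite ek /= addn1 in e.
by rewrite region1E // /fresh e /= !inordK ?ltnSn //= -e; apply: cnt_le.
Qed.

Lemma region_Sigma2_fresh k : (k.+1 < n)%N -> lt k = Sigma2Inv -> fresh k (region b k.+1 2).
Proof.
move=> kn ek; have e := cnt_succ 2 (ltnW kn); rewrite ek /= addn1 in e.
by rewrite region2E // /fresh e /= !inordK ?ltnSn ?orbT //= -e; apply: cnt_le.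
Qed.

Let top (q : state) : bool := if q is (MidTop | Top) then true else false.

(** The next band meets current faces whose connection or isolation the state records, and possibly
    a new face, isolated because it is fresh. So the state decides between [nonroot_sum_connected]
    and [nonroot_sum_isolated]. The inequality of faces ensures that the band of a [Sigma2Inv] read
    in [MidBot] has distinct ends; [k < n] keeps the right arcs out. *)
Lemma walk_invariant k : (k < n)%N ->
  [/\ if top (st k)
      then connect (edge_adj (edges k)) (region b k 3) (region b k 1)
        && isolated (edges k) (region b k 2)
      else [&& connect (edge_adj (edges k)) (region b k 0) (region b k 2),
        isolated (edges k) (region b k 1) & region b k 3 != region b k 1],
      forall f, fresh k f -> isolated (edges k) f
    & nonroot_sum sign (edges k) = (walk (take k b)).2].
Proof.
elim: k => [|k IHk] kn.
  split => //; rewrite ?take0.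
    by rewrite /st take0 /= andbT region1E // /cnt take0 /= connect0.
  rewrite /nonroot_sum big_pred0 // => f; apply/negbTE; rewrite negbK.
  by rewrite eq_sym -(isolated_connect (E := edges 0)) ?connect_root.
have kn' := ltnW kn; have{IHk} [conn iso sum] := IHk kn'.
have par l k' : (l < 4)%N -> odd (region b k' l).1 = odd l := @region_parity k' l.
have parN l l' k1 k2 : (l < 4)%N -> (l' < 4)%N -> odd l != odd l' ->
    region b k1 l != region b k2 l'.
  by move=> h h'; apply: contra => /eqP e; rewrite -(par l k1) // e par.
have nf l : (l < 4)%N -> ~~ fresh k.+1 (region b k l).
  by move=> h; apply/negP=> /(fresh_succ kn'); rewrite fresh_region.
have nf' l : (l < 4)%N -> ~~ fresh k.+1 (region b k.+1 l) by move=> h; rewrite fresh_region.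
have N02 : region b k 0 != region b k 2.
  rewrite region2E //; apply/eqP=> /(congr1 (fun f : face b => val f.1)) /=.
  by rewrite !inordK.
have Nfr f g : fresh k f -> ~~ fresh k g -> g != f.
  by move=> ff; apply: contra => /eqP->.
have nfk l : (l < 4)%N -> ~~ fresh k (region b k l) by move=> h; rewrite fresh_region.
have iso' u v : ~~ fresh k.+1 u -> ~~ fresh k.+1 v ->
    forall f, fresh k.+1 f -> isolated (rcons (edges k) (u, v)) f.
  move=> fu fv f ff; rewrite isolated_rcons (iso _ (fresh_succ kn' ff)) andbT.
  by apply/andP; split; apply/eqP=> ef; [rewrite -ef ff in fu | rewrite -ef ff in fv].
have sgn l k' : (l < 4)%N -> sign (region b k' l) = (-1) ^+ (~~ odd l).
  by move=> h; rewrite /sign par.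
have sign_next := edges_sign k.+1.
rewrite st_succ // edges_succ (take_nth Sigma1) // walk_rcons /step -/(st k) -/(lt k).
rewrite edges_succ in sign_next.
rewrite plat_crossingE in sign_next *.
have fr1 := @region_Sigma1_fresh k kn; have fr2 := @region_Sigma2_fresh k kn.
have e1 := @region1_Sigma2 k kn'; have e2 := @region2_Sigma1 k kn'.
(* The cases are [Bot], [MidBot], [MidTop], [Top] under [Sigma1], then under [Sigma2Inv]; the third
   to the sixth attach an isolated face. *)
case: (lt k) fr1 fr2 e1 e2 sign_next =>
    [/(_ erefl) fr _ _ /(_ erefl) e|_ /(_ erefl) fr /(_ erefl) e _];
  case: (st k) conn => /=.
- case/and3P=> c i1 n31 sE; split; last 1 first.
  + by rewrite nonroot_sum_connected ?sum ?addr0 // edge_adj_sym.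
  + have N31 : region b k.+1 3 != region b k.+1 1 := Nfr _ _ fr (nfk 3 isT).
    by rewrite e N31 connect_edge_rcons // isolated_rcons iso // !parN.
  + by apply: iso'; apply: nf.
- case/and3P=> c i1 n31 sE; split; last 1 first.
  + by rewrite nonroot_sum_connected ?sum ?addr0.
  + have N31 : region b k.+1 3 != region b k.+1 1 := Nfr _ _ fr (nfk 3 isT).
    by rewrite e N31 connect_edge_rcons // isolated_rcons iso // !parN.
  + by apply: iso'; apply: nf.
- case/andP=> c i2 sE; split; last 1 first.
  + by rewrite nonroot_sum_isolated // sum sgn.
  + have N31 : region b k.+1 3 != region b k.+1 1 := Nfr _ _ fr (nfk 3 isT).
    by rewrite e N31 connect_last_edge isolated_rcons iso // !parN.
  + by apply: iso'; apply: nf.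
- case/andP=> c i2 sE; split; last 1 first.
  + by rewrite nonroot_sum_isolated ?sum ?sgn ?iso // Nfr ?nfk.
  + rewrite e isolated_rcons i2 !parN // !andbT.
    by apply: connect_trans (connect_last_edge _ _ _); apply: connect_edge_rcons.
  + by apply: iso'; [apply: nf | apply: nf'].
- case/and3P=> c i1 n31 sE; split; last 1 first.
  + by rewrite nonroot_sum_isolated ?sum ?sgn ?iso // Nfr ?nfk.
  + rewrite e isolated_rcons i1 n31 !parN // !andbT.
    by apply: connect_trans (connect_last_edge _ _ _); apply: connect_edge_rcons.
  + by apply: iso'; [apply: nf | apply: nf'].
- case/and3P=> c i1 n31 sE; split; last 1 first.
  + by rewrite nonroot_sum_isolated // sum sgn.
  + by rewrite e connect_last_edge isolated_rcons iso // !parN.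
  + by apply: iso'; apply: nf.
- case/andP=> c i2 sE; split; last 1 first.
  + by rewrite nonroot_sum_connected ?sum ?addr0.
  + by rewrite e connect_edge_rcons // isolated_rcons iso // !parN.
  + by apply: iso'; apply: nf.
- case/andP=> c i2 sE; split; last 1 first.
  + by rewrite nonroot_sum_connected ?sum ?addr0 // edge_adj_sym.
  + by rewrite e connect_edge_rcons // isolated_rcons iso // !parN.
  + by apply: iso'; apply: nf.
Qed.

(* The last band joins two faces that are already connected. *)
Theorem plat_signature :
  diagram_signature (plat_diagram b) = (walk (take n.-1 b)).2.
Proof.
rewrite (alternating_signature (F := face b) (col := fun f => odd f.1)
  plat_alternating plat_balanced).
have e_n : n = n.-1.+1 by rewrite prednK.
have kn : (n.-1 < n)%N by rewrite -e_n.
have [conn _ <-] := walk_invariant kn.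
transitivity (nonroot_sum sign (edges n)).
  apply: eq_bigl => f; rewrite inE; congr (_ != _); apply: eq_root => {}f g.
  by rewrite /band_adjacent /edge_adj /plat_diagram !has_map.
rewrite [in LHS]e_n edges_succ nonroot_sum_connected // plat_crossingE.
move: last_state; rewrite -[b in walk b]take_size -/n [in take n]e_n -/(st _) st_succ //.
have -> : lt n.-1 = if odd n then Sigma1 else Sigma2Inv by rewrite -last_letter /lt nth_last.
rewrite -e_n; case on: (odd n); case: (st n.-1) conn => //=.
  by case/andP=> c _ _; rewrite region1_end // -(region_outer n.-1) edge_adj_sym.
by case/and3P=> c _ _ _; rewrite region2_end ?on // -(region_bottom n.-1) edge_adj_sym.
Qed.

End PlatDiagram.

(** * Words and runs *)

Definition run_len (s : bool) (x : letter) : nat := if is_Sigma1 x == s then 1 else 2.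

Fixpoint runs_of (s : bool) (b : seq letter) : seq (bool * nat) :=
  if b is x :: b' then (s, run_len s x) :: runs_of (~~ s) b' else [::].

(** Inverse to [letters] on words with runs of length 1 or 2, once the first symbol is fixed: the
    symbols of the runs alternate, so each letter determines its run. *)
Definition word_of (s : bool) (b : seq letter) : seq bool :=
  flatten [seq nseq r.2 r.1 | r <- runs_of s b].

Lemma runs_word_of s b : runs (word_of s b) = runs_of s b.
Proof.
elim: b s => //= x b IHb s; rewrite /word_of /= -/(word_of (~~ s) b) /run_len.
case: (_ == s) => /=; rewrite {}IHb; case: b => [|y b] //=; rewrite ?eqxx //.
  by case: s.
by case: s.
Qed.

Lemma run_letter_len s x : run_letter (s, run_len s x) = x.
Proof. by case: s; case: x. Qed.

Lemma map_run_letter_runs_of s b : map run_letter (runs_of s b) = b.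
Proof. by elim: b s => //= x b IHb s; rewrite run_letter_len IHb. Qed.

Lemma letters_word_of s b : letters (word_of s b) = b.
Proof. by rewrite /letters runs_word_of map_run_letter_runs_of. Qed.

Fixpoint alternates (s : bool) (r : seq (bool * nat)) : bool :=
  if r is p :: r' then (p.1 == s) && alternates (~~ s) r' else true.

Lemma runs_alternate s w : alternates (head s w) (runs w).
Proof.
elim: w s => //= a w IHw s; move: (IHw (~~ a)); case: (runs w) => [|[c k] r] /=.
  by rewrite eqxx.
case/andP=> /eqP<-; case: eqP => [<-|] /=; first by rewrite eqxx.
by case: a; case: c => //= _ ->; rewrite eqxx.
Qed.

Lemma runs_of_run_letter s (r : seq (bool * nat)) :
  alternates s r -> all (fun k => (k == 1%N) || (k == 2%N)) [seq p.2 | p <- r] ->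
  runs_of s (map run_letter r) = r.
Proof.
elim: r s => //= -[a k] r IHr s /andP[/eqP/= -> ar] /andP[hk /(IHr _ ar)->].
by congr ((_, _) :: _); case/orP: hk => /eqP->; case: s {ar}.
Qed.

Lemma flatten_runs w : flatten [seq nseq r.2 r.1 | r <- runs w] = w.
Proof.
elim: w => //= a w; case: (runs w) => [|[c k] r] /= <- //.
by case: eqP => [->|].
Qed.

Lemma word_of_letters s w :
  all (fun k => (k == 1%N) || (k == 2%N)) (run_lengths w) ->
  word_of (head s w) (letters w) = w.
Proof.
by move=> hw; rewrite /word_of runs_of_run_letter ?runs_alternate // flatten_runs.
Qed.

(** * The sum of the run lengths modulo 3 *)

Definition run_sum (b : seq letter) := sumn [seq r.2 | r <- runs_of true b].

Lemma runs_of_rcons s b x :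
  runs_of s (rcons b x) = rcons (runs_of s b) (s (+) odd (size b), run_len (s (+) odd (size b)) x).
Proof.
elim: b s => [|y b IHb] s /=; first by rewrite addbF.
by rewrite IHb addbN addNb.
Qed.

Lemma run_sum_rcons b x :
  run_sum (rcons b x) = (run_sum b + run_len (~~ odd (size b)) x)%N.
Proof. by rewrite /run_sum runs_of_rcons map_rcons sumn_rcons. Qed.

(** Each letter transposes two of the strands 1, 2, 3, so the parity of the size is the sign of the
    resulting permutation in [S_3]; the residue of [run_sum] selects one of the three permutations
    of that sign. The tables give the image of strand 3. *)
Lemma carry3_run_sum b : carry 3 b =
  if odd (size b) then nth 0%N [:: 1; 3; 2]%N (run_sum b %% 3)
  else nth 0%N [:: 3; 1; 2]%N (run_sum b %% 3).
Proof.
elim/last_ind: b => [//|b x IHb]; rewrite carry_rcons {}IHb run_sum_rcons size_rcons /=.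
rewrite -modnDml; have := ltn_pmod (run_sum b) (isT : (0 < 3)%N).
by case: (_ %% 3)%N => [|[|[|]]] //; case: x; case: (odd _).
Qed.

Lemma carry2_run_sum b : carry 2 b =
  if odd (size b) then nth 0%N [:: 2; 1; 3]%N (run_sum b %% 3)
  else nth 0%N [:: 2; 3; 1]%N (run_sum b %% 3).
Proof.
elim/last_ind: b => [//|b x IHb]; rewrite carry_rcons {}IHb run_sum_rcons size_rcons /=.
rewrite -modnDml; have := ltn_pmod (run_sum b) (isT : (0 < 3)%N).
by case: (_ %% 3)%N => [|[|[|]]] //; case: x; case: (odd _).
Qed.

Lemma size_runs_of s b : size (runs_of s b) = size b.
Proof. by elim: b s => //= x b IHb s; rewrite IHb. Qed.

Lemma size_word_of s b : (size (word_of s b) <= 2 * size b)%N.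
Proof.
elim: b s => //= x b IHb s; rewrite /word_of /= size_cat size_nseq mulnS.
by apply: leq_add (IHb _); rewrite /run_len; case: ifP.
Qed.

Lemma run_lengths_word_of s b :
  all (fun k => (k == 1%N) || (k == 2%N)) (run_lengths (word_of s b)).
Proof.
rewrite /run_lengths runs_word_of; elim: b s => //= x b IHb s.
by rewrite IHb /run_len; case: ifP.
Qed.

Definition last_of (c : nat) : letter := if odd c then Sigma1 else Sigma2Inv.

Definition end_state (c : nat) : state := if odd c then Top else Bot.

(** The last run is of + exactly for odd [c], and a run of length 1 gives [Sigma1] for + and
    [Sigma2Inv] for -. *)
Lemma in_T_word_of c b : size b = c -> (0 < c)%N ->
  in_T c (word_of true b) =
  [&& is_Sigma1 (head Sigma1 b), is_Sigma1 (last Sigma1 b) == odd c & run_sum b == 1 %[mod 3]].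
Proof.
move=> sb c_gt0; rewrite /in_T run_lengths_word_of /run_lengths runs_word_of.
rewrite size_map size_runs_of sb eqxx -/(run_sum b) /= andbA.
have -> : head false (word_of true b) && (head 0%N [seq r.2 | r <- runs_of true b] == 1%N)
    = is_Sigma1 (head Sigma1 b).
  case: b sb => [|x b] sb; first by rewrite -sb in c_gt0.
  by rewrite /word_of /= /run_len; case: (is_Sigma1 x).
congr (_ && _); case/lastP: b sb => [|b x] sb; first by rewrite -sb in c_gt0.
rewrite runs_of_rcons map_rcons !last_rcons -sb size_rcons /= /run_len.
by congr (_ && _); case: (is_Sigma1 x); case: (odd _).
Qed.

(** Heights 1 and 3 belong to one state each, so the permutation, hence the congruence, determines
    whether the walk ends in that state. *)
Lemma run_sum_end_state b :
  (run_sum b == 1 %[mod 3])%N <-> (walk b).1 = end_state (size b).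
Proof.
have := height_walk b; rewrite carry3_run_sum /end_state (modn_small (isT : (1 < 3)%N)).
have := ltn_pmod (run_sum b) (isT : (0 < 3)%N).
by case: (odd _); case: (_ %% 3)%N => [|[|[|]]] //; case: (walk b).1.
Qed.

Lemma word_signatureE c w : in_T c w -> (0 < c)%N ->
  word_signature w = (walk (take c.-1 (letters w))).2.
Proof.
move=> Tw c_gt0; have /and4P[sw lens hw _] := Tw.
have sb : size (letters w) = c by rewrite -(eqP sw) !size_map.
have ew : word_of true (letters w) = w.
  by rewrite -[in RHS](word_of_letters true lens); case: (w) hw => //= a w' ->.
move: Tw; rewrite -{1}ew in_T_word_of // => /and3P[_ /eqP last_b sum_b].
rewrite /word_signature plat_signature ?sb //.
- by rewrite -last_b; case: last.
(* Strand 2 ends at the strand that a right arc ties to strand 0, so both would run to the right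
   under [left_end true]. *)
- rewrite /right_end_ok !transport_left_end carry2_run_sum sb (eqP sum_b).
  by case: (odd c).
- by rewrite -sb; apply/run_sum_end_state.
Qed.

(** * Counting *)

Lemma is_Sigma1K : cancel is_Sigma1 (fun x => if x then Sigma1 else Sigma2Inv).
Proof. by case. Qed.

HB.instance Definition _ := Equality.copy letter (can_type is_Sigma1K).

(** Letters are appended on the right, so that the last step of the walk gives the recursion
    [walks_succ]. *)
Fixpoint letter_seqs (k : nat) : seq (seq letter) :=
  if k is k'.+1 then
    [seq rcons b Sigma1 | b <- letter_seqs k'] ++ [seq rcons b Sigma2Inv | b <- letter_seqs k']
  else [:: [::]].

Lemma mem_letter_seqs k b : (b \in letter_seqs k) = (size b == k).
Proof.
elim: k b => [|k IHk] b /=; first by rewrite inE size_eq0.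
rewrite mem_cat; apply/orP/idP => [[]/mapP[b']|].
- by rewrite IHk => /eqP <- ->; rewrite size_rcons.
- by rewrite IHk => /eqP <- ->; rewrite size_rcons.
case/lastP: b => // b x; rewrite size_rcons eqSS -IHk => hb.
by case: x; [left|right]; apply: map_f.
Qed.

Lemma letter_seqs_uniq k : uniq (letter_seqs k).
Proof.
elim: k => //= k IHk; rewrite cat_uniq !map_inj_uniq ?IHk ?andbT /=;
  try by move=> ? ? /rcons_inj[].
by apply/hasPn=> _ /mapP[b _ ->]; apply/mapP=> -[b' _ /rcons_inj[]].
Qed.

Definition same_state (p q : state) : bool :=
  match p, q with
  | Bot, Bot | MidBot, MidBot | MidTop, MidTop | Top, Top => true
  | _, _ => false
  end.

Definition walks (k : nat) (q : state) (j : int) : nat :=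
  count (fun b => same_state (walk b).1 q && ((walk b).2 == j)) (letter_seqs k).

Lemma walks0 q j : walks 0 q j = same_state Top q && (0 == j) :> nat.
Proof. by rewrite /walks /= addn0. Qed.

Lemma walks_succ k q j : walks k.+1 q j =
  match q with
  | Bot => walks k Bot (j + 1) + walks k MidBot j + walks k MidTop (j + 1)
  | MidBot => walks k Bot j
  | MidTop => walks k Top j
  | Top => walks k Top (j - 1) + walks k MidBot (j - 1) + walks k MidTop j
  end%N.
Proof.
rewrite /walks /= count_cat !count_map.
elim: (letter_seqs k) => [|b s IHs] /=; first by case: q.
rewrite !walk_rcons addnACA {}IHs; case: (walk b) => p v /=.
have e1 : (v + 1 == j) = (v == j - 1) by apply/eqP/eqP; lia.
have e2 : (v - 1 == j) = (v == j + 1) by apply/eqP/eqP; lia.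
by case: q; case: p; rewrite /= ?addr0 ?e1 ?e2; lia.
Qed.

(** Both end letters of an element of [T c.+2] are prescribed; only the [c] letters between them are
    free. The first is a loop at [Top] of gain 1, whence [j - 1], and [plat_signature] leaves out
    the last. *)
Lemma card_T_signature c j :
  s c.+2 j = walks c (end_state c) (j - 1).
Proof.
pose long mid := Sigma1 :: rcons mid (last_of c).
pose w_of mid : (2 * c.+2).-bseq bool := insub_bseq _ (word_of true (long mid)).
pose good mid := same_state (walk mid).1 (end_state c) && ((walk mid).2 == j - 1).
have size_long mid : mid \in letter_seqs c -> size (long mid) = c.+2.
  by rewrite mem_letter_seqs /= size_rcons => /eqP->.
have w_ofE mid : mid \in letter_seqs c -> w_of mid = word_of true (long mid) :> seq bool.
  move=> /size_long sm; rewrite val_insubd -[in X in (_ <= X)%N]sm.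
  by rewrite size_word_of.
have walk_long (mid : seq letter) : walk (Sigma1 :: mid) = ((walk mid).1, (walk mid).2 + 1).
  elim/last_ind: mid => // mid x IH.
  by rewrite -rcons_cons !walk_rcons IH /step /= addrAC.
have T_long mid : mid \in letter_seqs c ->
    (w_of mid \in T c.+2) && (word_signature (w_of mid) == j) = good mid.
  move=> hmid; have sm := size_long _ hmid; rewrite inE.
  have sigE : in_T c.+2 (w_of mid) -> word_signature (w_of mid) = (walk mid).2 + 1.
    move=> Tw; rewrite (word_signatureE Tw) // w_ofE // letters_word_of.
    rewrite /long -rcons_cons -cats1 take_size_cat; last first.
      by move: sm; rewrite /= size_rcons => -[->].
    by rewrite walk_long.
  (* The letter [last_of c] leads to [end_state c] from that state only. *)
  have TE : in_T c.+2 (w_of mid) = same_state (walk mid).1 (end_state c).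
    rewrite w_ofE // in_T_word_of // [last _ _]/= last_rcons [is_Sigma1 (head _ _)]/=.
    have -> : is_Sigma1 (last_of c) == odd c.+2 by rewrite /last_of /= negbK; case: (odd c).
    rewrite /=; apply/idP/idP => [/run_sum_end_state|same].
      rewrite sm /long -rcons_cons walk_rcons walk_long /= /end_state /last_of /= negbK.
      by case: (odd c); case: (walk mid).1.
    apply/run_sum_end_state; rewrite sm /long -rcons_cons walk_rcons walk_long /=.
    move: same; rewrite /end_state /last_of /= negbK.
    by case: (odd c); case: (walk mid).1.
  rewrite /good -TE; case: (boolP (in_T _ _)) => //= /sigE ->.
  by apply/eqP/eqP; lia.
have w_of_inj : {in letter_seqs c &, injective w_of}.
  move=> mid mid' hm hm' /(congr1 (@bseqval _ _)); rewrite !w_ofE //.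
  by move/(congr1 letters); rewrite !letters_word_of => -[] /rcons_inj[].
have -> : s c.+2 j = size [seq w_of mid | mid <- letter_seqs c & good mid].
  rewrite -(card_uniqP _); last first.
    rewrite map_inj_in_uniq ?filter_uniq ?letter_seqs_uniq //.
    by move=> mid mid'; rewrite !mem_filter => /andP[_ hm] /andP[_ hm']; apply: w_of_inj.
  apply: eq_card => w; rewrite inE; apply/andP/mapP => [[Tw sw]|[mid]]; last first.
    by rewrite mem_filter => /andP[gm hm] ->; apply/andP; rewrite T_long.
  have Tw' : in_T c.+2 w by rewrite inE in Tw.
  have /and4P[sb lens hw _] := Tw'.
  have{}sb : size (letters w) = c.+2 by rewrite -[RHS](eqP sb) !size_map.
  have ew : word_of true (letters w) = w.
    by rewrite -[in RHS](word_of_letters true lens); case: (val w) hw => //= a w' ->.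
  move: Tw'; rewrite -{1}ew in_T_word_of // => /and3P[hd_b last_b _].
  have [mid eb hm] : exists2 mid, letters w = long mid & mid \in letter_seqs c.
    case: (letters w) sb hd_b last_b => [//|x b'] /=; case/lastP: b' => [//|mid y].
    rewrite size_rcons last_rcons => -[sm] hx /eqP hy; exists mid; last first.
      by rewrite mem_letter_seqs sm.
    by rewrite /long /last_of; case: x hx => // _; case: y hy => /=; case: (odd c).
  have ew' : w = w_of mid by apply/val_inj; rewrite /= w_ofE // -eb.
  by exists mid; rewrite // mem_filter hm andbT -T_long // -ew' Tw.
by rewrite size_map size_filter.
Qed.

(* The coefficient of [t^j] in [(t + 1/t)^k]. *)
Fixpoint tau (k : nat) (j : int) : nat :=
  if k is k'.+1 then (tau k' (j - 1)%R + tau k' (j + 1)%R)%N else (j == 0 :> int).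

(** Choosing [t] in [i] of the [k] factors gives the exponent 2i - k; the induction is Pascal's
    rule. *)
Lemma tau_binomial k (i : int) : tau k (2 * i - k%:Z) = binomialz k i.
Proof.
elim: k i => [|k IHk] i /=.
  case: i => [[|i]|i] //=.
have -> : 2 * i - k.+1%:Z - 1 = 2 * (i - 1) - k%:Z by lia.
have -> : 2 * i - k.+1%:Z + 1 = 2 * i - k%:Z by lia.
rewrite !IHk; case: i => [[|i]|i].
- by rewrite /= !bin0.
- by rewrite (_ : Posz i.+1 - 1 = Posz i) /= ?binS 1?addnC //; lia.
- by rewrite (_ : Negz i - 1 = Negz i.+1) //; lia.
Qed.

(** * Recurrences and closed forms for the walk counts *)

Lemma walks_Bot_succ2 k j :
  walks k.+2 Bot j = (walks k Bot j + (walks k Top (j + 1) + walks k.+1 Bot (j + 1)))%N.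
Proof.
rewrite walks_succ [walks k.+1 MidBot _]walks_succ [walks k.+1 MidTop _]walks_succ; lia.
Qed.

Lemma walks_Top_succ2 k j :
  walks k.+2 Top j = (walks k Top j + (walks k.+1 Top (j - 1)%R + walks k Bot (j - 1)%R))%N.
Proof.
rewrite walks_succ [walks k.+1 MidBot _]walks_succ [walks k.+1 MidTop _]walks_succ; lia.
Qed.

(** The two identities need a joint induction: after a two-step expansion each of them at [k.+1] is
    a sum of values of both at [k], added by the rule defining [tau]. *)
Lemma walks_tau k :
  (forall j, walks k Top j + walks k.+1 Bot j = tau k j)%N /\
  (forall j, walks k.+1 Top j + walks k Bot j = tau k (j - 1)%R)%N.
Proof.
elim: k => [|k [IH1 IH2]].
  by split=> j; rewrite !walks_succ !walks0 /= !addn0 eq_sym.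
split=> j; first by rewrite walks_Bot_succ2 IH1 addnA IH2.
by rewrite walks_Top_succ2 IH2 addnAC IH1 /= subrK addnC.
Qed.

Lemma walks_Bot2 k j : walks k.+2 Bot j = (walks k Bot j + tau k (j + 1)%R)%N.
Proof. by rewrite walks_Bot_succ2 (walks_tau k).1. Qed.

Lemma walks_Top2 k j : walks k.+2 Top j = (walks k Top j + tau k (j - 2)%R)%N.
Proof. by rewrite walks_Top_succ2 (walks_tau k).2 -addrA. Qed.

Lemma walks_Bot_even r j :
  walks (2 * r) Bot j = (\sum_(0 <= i < r) tau (2 * (r - i.+1)) (j + 1)%R)%N.
Proof.
elim: r => [|r IHr]; first by rewrite walks0 big_nil.
rewrite mulnS walks_Bot2 IHr big_nat_recl // subSS subn0 addnC; congr (_ + _)%N.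
Qed.

(** The separate term is the walk of length 1, the loop [Sigma1] at [Top]; it becomes the
    exceptional 1 at n = 1. *)
Lemma walks_Top_odd r j :
  walks (2 * r).+1 Top j =
  ((j == 1 :> int) + \sum_(0 <= i < r) tau (2 * (r - i.+1)).+1 (j - 2)%R)%N.
Proof.
elim: r => [|r IHr].
  by rewrite big_nil walks_succ !walks0 /= !addn0; congr nat_of_bool; apply/eqP/eqP; lia.
rewrite mulnS walks_Top2 IHr big_nat_recl // subSS subn0 -addnA; congr (_ + _)%N.
by rewrite addnC; congr (_ + _)%N.
Qed.

(** * Ranges of summation *)

Lemma eq_sum_upto (u : int) (f g : nat -> nat) : f =1 g -> sum_upto u f = sum_upto u g.
Proof. by move=> fg; case: u => //= u; apply: eq_bigr => i _. Qed.

(** Trades an upper limit depending on [n] for a uniform one, the extra binomials being 0. *)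
Lemma sum_upto_truncate (u : int) (N : nat) (f : nat -> nat) :
  u < N%:Z -> (forall i, u < i%:Z -> (i < N)%N -> f i = 0%N) ->
  sum_upto u f = (\sum_(0 <= i < N) f i)%N.
Proof.
case: u => u hu f0 /=.
  rewrite [RHS](big_cat_nat (n := u.+1)) //=.
  rewrite [X in (_ + X)%N]big1_seq ?addn0 // => i; rewrite mem_index_iota => /and3P[_ hi hN].
  by apply: f0; rewrite ?ltz_nat.
rewrite big1_seq // => i; rewrite mem_index_iota => /and3P[_ hi hN].
by apply: f0 => //; lia.
Qed.

Lemma binomialz_small (a b : int) : a < b -> binomialz a b = 0%N.
Proof. by case: a => a; case: b => b //= ab; rewrite bin_small. Qed.

Lemma binomialz_neg (a b : int) : b < 0 -> binomialz a b = 0%N.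
Proof. by case: a; case: b. Qed.

Lemma s_even m n : (3 <= 2 * m)%N ->
  s (2 * m) (2 * n) = (\sum_(0 <= i < m.-1)
    binomialz (2 * m%:Z - 4 - 2 * i%:Z) (m%:Z + n - 2 - i%:Z))%N.
Proof.
case: m => [|m] // _; rewrite mulnS card_T_signature /end_state mul2n odd_double -mul2n.
rewrite walks_Bot_even; apply: eq_big_nat => i /andP[_ im].
(* The exponent is put in the form 2i - k required by [tau_binomial]. *)
rewrite (_ : 2 * n - 1 + 1 = 2 * (m.+1%:Z + n - 2 - i%:Z) - (2 * (m - i.+1))%:Z); last lia.
by rewrite tau_binomial; congr binomialz; lia.
Qed.

Lemma s_odd m n : (3 <= 2 * m + 1)%N ->
  s (2 * m + 1) (2 * n) = ((n == 1 :> int) + \sum_(0 <= i < m.-1)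
    binomialz (2 * m%:Z - 3 - 2 * i%:Z) (m%:Z + n - 3 - i%:Z))%N.
Proof.
case: m => [|m] // _; rewrite mulnS addn1 card_T_signature /end_state.
rewrite -[in X in if X then _ else _]addn1 mul2n oddD odd_double -mul2n /=.
rewrite walks_Top_odd; congr (_ + _)%N; first by congr nat_of_bool; apply/eqP/eqP; lia.
apply: eq_big_nat => i /andP[_ im].
rewrite (_ : 2 * n - 1 - 2 = 2 * (m.+1%:Z + n - 3 - i%:Z) - (2 * (m - i.+1)).+1%:Z); last lia.
by rewrite tau_binomial; congr binomialz; lia.
Qed.

Theorem theorem1p2 :
  (forall (m : nat) (n : int), (3 <= 2 * m)%N ->
     s (2 * m) (2 * n)
     = sum_upto (m%:Z - `|n| - 2)
         (fun i => binomialz (2 * m%:Z - 4 - 2 * i%:Z) (m%:Z + n - 2 - i%:Z)))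
  /\
  (forall (m : nat) (n : int), (3 <= 2 * m + 1)%N -> n <> 1 ->
     s (2 * m + 1) (2 * n)
     = sum_upto (Num.min (m%:Z + n - 3) (m%:Z - n))
         (fun i => binomialz (2 * m%:Z - 3 - 2 * i%:Z) (m%:Z + n - 3 - i%:Z)))
  /\
  (forall m : nat, (3 <= 2 * m + 1)%N ->
     s (2 * m + 1) 2
     = (1 + sum_upto (m%:Z - 2)
              (fun i => binomialz (2 * m%:Z - 3 - 2 * i%:Z)
                                  (m%:Z - 2 - i%:Z)))%N
     /\
     s (2 * m + 1) 2
     = (1 + sum_upto (Num.min (m%:Z + 1 - 3) (m%:Z - 1))%R
              (fun i => binomialz (2 * m%:Z - 3 - 2 * i%:Z)
                                  (m%:Z + 1 - 3 - i%:Z)))%N).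
Proof.
have odd_sum m (n : int) : (3 <= 2 * m + 1)%N ->
    s (2 * m + 1) (2 * n) = ((n == 1 :> int) +
      sum_upto (Num.min (m%:Z + n - 3) (m%:Z - n))%R
        (fun i => binomialz (2 * m%:Z - 3 - 2 * i%:Z) (m%:Z + n - 3 - i%:Z)))%N.
  move=> m_gt0; rewrite s_odd // (@sum_upto_truncate _ m.-1) //; first by lia.
  (* Past the first bound of the minimum the lower index is negative; past the second it exceeds the
     upper index. *)
  move=> i ui im; have [lt_i|le_i] := ltP (m%:Z + n - 3) i%:Z.
    by apply: binomialz_neg; lia.
  by apply: binomialz_small; lia.
split=> [m n m_gt1|].
  rewrite s_even // (@sum_upto_truncate _ m.-1) //; first by lia.
  (* For negative [n] the lower index is negative, otherwise it exceeds the upper one. *)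
  move=> i ui im; have [lt_n|le_n] := ltP n 0; first by apply: binomialz_neg; lia.
  by apply: binomialz_small; lia.
split=> [m n m_gt0 /eqP/negbTE n1|m m_gt0]; first by rewrite odd_sum // n1.
have e := odd_sum m 1 m_gt0; rewrite mulr1 eqxx in e.
split; rewrite e //; congr (1 + _)%N.
rewrite (_ : Num.min _ _ = m%:Z - 2); last lia.
by apply: eq_sum_upto => i; congr binomialz; lia.
Qed.
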